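(* Let $H$ be a bounded Schrödinger operator on a uniform infinite graph $G$. Assume there exists $\alpha>0$ such that $$\sup_{r\in\mathbb{N}}\frac{N(r)}{S(r)}\le\alpha .$$ For each $r\in\mathbb{N}$ let $f_r:\mathbb{N}\cup\{0\}\to[0,1]$ be a monotonically decreasing function with $f_r(0)=1$, $f_r(k)\ne0$ for $0\le k\le r$ and $f_r(k)=0$ for $k>r$; for $u,v\in G$ let $\chi_{u,r}(v)=f_r(\mathrm{dist}(v,u))$, and let $$C^{(r)}=-\sum_{u\in G}2\,[H,\chi_{u,r}]^2,$$ where $\chi_{u,r}$ is regarded as a multiplication operator. Then for all $r\in\mathbb{N}$ and all $v\in G$ the diagonal matrix element $C^{(r)}_{v,v}=\langle\delta_v,C^{(r)}\delta_v\rangle$ satisfies $$\left|C^{(r)}_{v,v}\right|>\frac{1}{2\alpha}.$$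
   Context: Graphs are simple, undirected and connected; a graph $G$ is identified with its vertex set $V(G)$, $u\sim v$ means that $u,v$ are adjacent, and $\mathrm{dist}$ is the graph distance. A Schrödinger operator on a graph $G$ of bounded degree is an operator $H$ on $\ell^2(G)$ acting by $(H\psi)(v)=\sum_{u\sim v}(\psi(u)-\psi(v))+Q(v)\psi(v)$, where $Q:V(G)\to\mathbb{R}$ is bounded. Let $N_u(k)=|\{v\in G:\mathrm{dist}(u,v)\le k\}|$. The graph $G$ is called uniform if $N_u(k)=N_v(k)$ for all vertices $u,v\in G$ and all $k\in\mathbb{N}$; the common value is denoted $N(k)$ (with $N(0)=1$), and $S(k)=N(k)-N(k-1)$ is the number of vertices at distance exactly $k$ from any given vertex. $[A,B]=AB-BA$, and $\delta_v$ is the delta function at $v$. *)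

(* Defs.v *)
From HB Require Import structures.
From mathcomp Require Import all_boot all_order all_algebra.
From mathcomp Require Import finmap.
From mathcomp Require Import mathcomp_extra boolp classical_sets functions.
From mathcomp Require Import cardinality fsbigop reals ereal topology.
From mathcomp Require Import normedtype sequences esum.
From mathcomp Require Import complex.
From mathcomp Require Import ring lra.

Set Implicit Arguments.
Unset Strict Implicit.
Unset Printing Implicit Defensive.

Import Order.TTheory GRing.Theory Num.Theory.
Import numFieldNormedType.Exports Normc.

Local Open Scope classical_set_scope.
Local Open Scope card_scope.
Local Open Scope ring_scope.
Local Open Scope complex_scope.

Section graphs.
Variables (V : choiceType) (e : rel V).

Definition simple_graph := symmetric e /\ irreflexive e.

Definition walk (u v : V) (n : nat) : Prop :=
  exists p : seq V, [/\ path e u p, last u p = v & size p = n].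

Definition connected_graph := forall u v, exists n, walk u v n.

Definition bounded_degree :=
  exists d, forall v, [set u | e u v] #<= `I_d.

(* The value 0 for vertices joined by no walk is never used: graphs are
   assumed connected. *)
Definition dist (u v : V) : nat :=
  if pselect (exists n, `[< walk u v n >]) is left h then ex_minn h else 0.

Definition ball (u : V) (k : nat) : set V := [set v | (dist u v <= k)%N].

(* [fset_set] is meaningful on finite sets only; see [finite_ball]. *)
Definition ball_card (u : V) (k : nat) : nat := #|` fset_set (ball u k)|.

Definition uniform_graph := forall u v k, ball_card u k = ball_card v k.

Lemma walk_dist u v : connected_graph -> walk u v (dist u v).
Proof.
move=> conn; rewrite /dist; case: pselect => [h|[]].
  by case: ex_minnP => m /asboolP.
by have [n wn] := conn u v; exists n; apply/asboolP.
Qed.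

Lemma dist_walk u v n : walk u v n -> (dist u v <= n)%N.
Proof.
move=> wn; rewrite /dist; case: pselect => [h|//].
by case: ex_minnP => m _; apply; apply/asboolP.
Qed.

Lemma finite_ball u k :
  simple_graph -> connected_graph -> bounded_degree -> finite_set (ball u k).
Proof.
move=> [esym _] conn [d dP].
have finN v : finite_set [set w | e w v].
  exact: (card_le_finite (dP v) (finite_II d)).
elim: k => [|k IH].
  apply: (@sub_finite_set _ _ [set u]) => // v; rewrite /ball /= leqn0 => /eqP d0.
  have [p [_ lp sp]] := walk_dist u v conn.
  by rewrite -lp; move: sp; rewrite d0 => /size0nil ->.
apply: (@sub_finite_set _ _
  ([set u] `|` \bigcup_(w in ball u k) [set v | e v w])); last first.
  by rewrite finite_setU; split => //; apply: bigcup_finite.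
move=> v vk; have [p [pp lp sp]] := walk_dist u v conn.
case/lastP: p pp lp sp => [|p x]; first by move=> _ <- _; left.
rewrite rcons_path last_rcons size_rcons => /andP[pp ex] xv sp; right.
exists (last u p); last by rewrite /= esym -xv.
apply: (@leq_trans (size p)); first by apply: dist_walk; exists p.
by rewrite -ltnS sp.
Qed.

End graphs.

(* Number of vertices at distance exactly [k], from the common ball sizes [N],
   with the convention N(-1) = 0. *)
Definition sphere_card (N : nat -> nat) (k : nat) : nat :=
  if k is k'.+1 then (N k - N k')%N else N 0%N.

Lemma young_sqr (F : realFieldType) (a b s t : F) : 0 < s -> s * t = 1 ->
  (a + b) ^+ 2 <= (1 + s) * a ^+ 2 + (1 + t) * b ^+ 2.
Proof.
move=> s0 st1; have t0 : 0 < t by rewrite -(pmulr_rgt0 _ s0) st1.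
have : 0 <= t * (s * a - b) ^+ 2 by rewrite mulr_ge0 ?sqr_ge0 // ltW.
have -> : t * (s * a - b) ^+ 2
  = (s * t) * s * a ^+ 2 - 2 * (s * t) * a * b + t * b ^+ 2 by ring.
by rewrite st1; lra.
Qed.

Section ell2.
Variables (R : realType) (V : choiceType).
Local Notation C := (R[i]).

Definition sqnorm (psi : V -> C^o) : \bar R :=
  \esum_(v in [set: V]) (normc (psi v) ^+ 2)%:E.

Definition square_summable : {pred V -> C^o} := [pred psi | (sqnorm psi < +oo)%E].

Lemma normc_ge0 (z : C) : 0 <= normc z.
Proof. by case: z => a b; exact: sqrtr_ge0. Qed.

Lemma normcD (z w : C) : normc (z + w) <= normc z + normc w.
Proof. exact: le_normcD. Qed.

Lemma sqnorm_ge0 psi : (0 <= sqnorm psi)%E.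
Proof. by apply: esum_ge0 => v _; rewrite lee_fin sqr_ge0. Qed.

Lemma sqnorm_le psi (M : R) :
  (forall A : set V, finite_set A ->
     \sum_(v \in A) normc (psi v) ^+ 2 <= M) ->
  (sqnorm psi <= M%:E)%E.
Proof.
move=> h; apply: ge_ereal_sup => _ [A [finA _] <-].
by rewrite fsumEFin // lee_fin; exact: h.
Qed.

Lemma le_sqnorm psi (A : set V) : finite_set A -> (sqnorm psi < +oo)%E ->
  \sum_(v \in A) normc (psi v) ^+ 2 <= fine (sqnorm psi).
Proof.
move=> finA psioo; rewrite -lee_fin fineK; last first.
  by rewrite ge0_fin_numE // sqnorm_ge0.
by rewrite -fsumEFin //; apply: ereal_sup_ubound; exists A.
Qed.

Lemma sqnorm_young (phi psi : V -> C^o) (s t : R) : 0 < s -> s * t = 1 ->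
  (sqnorm phi < +oo)%E -> (sqnorm psi < +oo)%E ->
  (sqnorm (phi + psi)%R <=
    ((1 + s) * fine (sqnorm phi) + (1 + t) * fine (sqnorm psi))%R%:E)%E.
Proof.
move=> s0 st1 phioo psioo; apply: sqnorm_le => A finA.
have t0 : 0 < t by rewrite -(pmulr_rgt0 _ s0) st1.
apply: (@le_trans _ _ ((1 + s) * \sum_(v \in A) normc (phi v) ^+ 2
   + (1 + t) * \sum_(v \in A) normc (psi v) ^+ 2)); last first.
  by apply: lerD; rewrite ler_pM2l ?le_sqnorm // addr_gt0.
rewrite !fsbig_finite // !mulr_sumr -big_split /=; apply: ler_sum => v _.
apply: (@le_trans _ _
  ((normc (phi v) + normc (psi v)) ^+ 2)).
  by rewrite lerXn2r ?nnegrE ?addr_ge0 ?normc_ge0 // normcD.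
exact: young_sqr.
Qed.

Lemma sqnorm0 : sqnorm 0 = 0%E.
Proof.
by apply: esum1 => v _; rewrite normc0 expr0n.
Qed.

Lemma sqnormZ (c : C) psi : (sqnorm psi < +oo)%E ->
  sqnorm (c *: psi) = (normc c ^+ 2 * fine (sqnorm psi))%:E.
Proof.
have key (d : C) (phi : V -> C^o) : (sqnorm phi < +oo)%E ->
    (sqnorm (d *: phi)%R <= (normc d ^+ 2 * fine (sqnorm phi))%R%:E)%E.
  move=> phioo; apply: sqnorm_le => A finA.
  apply: (@le_trans _ _ (normc d ^+ 2 *
      \sum_(v \in A) normc (phi v) ^+ 2)); last first.
    by rewrite ler_wpM2l ?sqr_ge0 ?le_sqnorm.
  rewrite !fsbig_finite // mulr_sumr; apply: ler_sum => v _.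
  by rewrite -exprMn -normcM.
move=> psioo; have [->|c0] := eqVneq c 0.
  by rewrite scale0r sqnorm0 normc0 expr0n mul0r.
apply/eqP; rewrite eq_le key //=.
have cpoo : (sqnorm (c *: psi)%R < +oo)%E by apply: le_lt_trans (key c _ psioo) (ltry _).
have /= := key c^-1 _ cpoo; rewrite scalerA mulVf // scale1r.
have nc0 : normc c != 0.
  by apply: contra c0 => /eqP/eq0_normc ->.
rewrite normcV exprVn -[X in (X <= _)%E]fineK; last first.
  by rewrite ge0_fin_numE // sqnorm_ge0.
rewrite lee_fin mulrC ler_pdivlMr ?exprn_gt0 ?lt_def ?nc0 ?normc_ge0 // mulrC => h.
rewrite -[leRHS]fineK ?lee_fin // ge0_fin_numE // sqnorm_ge0 //.
Qed.

Lemma square_summable_submod_closed : submod_closed square_summable.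
Proof.
split; first by rewrite inE sqnorm0.
move=> c phi psi; rewrite !inE => phioo psioo.
have cphioo : (sqnorm (c *: phi)%R < +oo)%E by rewrite sqnormZ // ltry.
have := @sqnorm_young (c *: phi) psi 1 1 ltr01 (mulr1 _) cphioo psioo.
by move=> /le_lt_trans; apply; rewrite ltry.
Qed.

HB.instance Definition _ := GRing.isSubmodClosed.Build C (V -> C^o)
  square_summable square_summable_submod_closed.

Record ell2 := Ell2 {
  ell2_fun :> V -> C^o ;
  ell2_summable : ell2_fun \in square_summable }.

HB.instance Definition _ := [isSub for ell2_fun].
HB.instance Definition _ := [Choice of ell2 by <:].
HB.instance Definition _ := [SubChoice_isSubLmodule of ell2 by <:].

Definition ell2_norm (psi : ell2) : C :=
  (Num.sqrt (fine (sqnorm psi)))%:C.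

Lemma sqnorm_fin (psi : ell2) : (sqnorm psi < +oo)%E.
Proof. exact: (ell2_summable psi). Qed.

Lemma ell2_normZ (c : C) (psi : ell2) :
  ell2_norm (c *: psi) = `|c| * ell2_norm psi.
Proof.
rewrite /ell2_norm [sqnorm _](@sqnormZ c psi) ?sqnorm_fin //=.
by rewrite sqrtrM ?sqr_ge0 // sqrtr_sqr ger0_norm ?normc_ge0 // rmorphM.
Qed.

Lemma ell2_norm0_eq0 (psi : ell2) : ell2_norm psi = 0 -> psi = 0.
Proof.
move=> [] /eqP; rewrite sqrtr_eq0 => n0; apply/val_inj/funext => v /=.
apply: eq0_normc; apply/eqP; rewrite -sqrf_eq0 eq_le sqr_ge0 andbT.
apply: le_trans n0.
have := @le_sqnorm psi [set v] (finite_set1 v) (sqnorm_fin psi).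
by rewrite fsbig_set1.
Qed.

Lemma ell2_normD (phi psi : ell2) :
  ell2_norm (phi + psi) <= ell2_norm phi + ell2_norm psi.
Proof.
have [/eqP p0|p0] := boolP (ell2_norm phi == 0).
  by rewrite p0 (ell2_norm0_eq0 p0) !add0r.
have [/eqP q0|q0] := boolP (ell2_norm psi == 0).
  by rewrite q0 (ell2_norm0_eq0 q0) !addr0.
rewrite /ell2_norm -rmorphD lecR.
set x := Num.sqrt (fine (sqnorm phi)); set y := Num.sqrt (fine (sqnorm psi)).
have x0 : 0 < x.
  by rewrite lt_def sqrtr_ge0 andbT; apply: contra p0; rewrite /ell2_norm -/x => /eqP->.
have y0 : 0 < y.
  by rewrite lt_def sqrtr_ge0 andbT; apply: contra q0; rewrite /ell2_norm -/y => /eqP->.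
have sq (f : V -> C^o) : (Num.sqrt (fine (sqnorm f))) ^+ 2 = fine (sqnorm f).
  by rewrite sqr_sqrtr // fine_ge0 // sqnorm_ge0.
have st : (y / x) * (x / y) = 1.
  by rewrite mulrA divfK ?gt_eqF // divff // gt_eqF.
have := @sqnorm_young phi psi (y / x) (x / y) (divr_gt0 y0 x0) st
  (sqnorm_fin phi) (sqnorm_fin psi).
rewrite -(sq phi) -(sq psi) -/x -/y -[X in (X <= _)%E]fineK; last first.
  by rewrite ge0_fin_numE ?sqnorm_ge0 //; exact: (sqnorm_fin (phi + psi)).
rewrite lee_fin => h.
have xyE : (1 + y / x) * x ^+ 2 + (1 + x / y) * y ^+ 2 = (x + y) ^+ 2.
  by field; rewrite !gt_eqF.
rewrite xyE in h; have xy0 : 0 <= x + y by rewrite addr_ge0 // ltW.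
by rewrite -(ger0_norm xy0) -sqrtr_sqr; apply: ler_wsqrtr.
Qed.

HB.instance Definition _ := Lmodule_isNormed.Build C ell2
  ell2_normD ell2_normZ ell2_norm0_eq0.

Lemma delta_summable (v : V) :
  (fun w => (w == v)%:R) \in square_summable.
Proof.
rewrite inE; have -> : sqnorm (fun w => (w == v)%:R) = \esum_(w in [set v]) 1%E.
  rewrite [RHS]esum_mkcond; apply: eq_esum => w _.
  have -> : (w \in [set v]) = (w == v) by apply/idP/eqP; rewrite inE.
  by case: eqP => _; rewrite ?normc1 ?normc0 ?expr1n ?expr0n.
by rewrite esum_set1 // ltry.
Qed.

Definition delta (v : V) : ell2 := Ell2 (delta_summable v).

(* Pointwise multiplication; the default value 0 covers the products that
   are not square summable, and does not occur for bounded [g]: see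
   [mulopE]. *)
Definition mulop (g : V -> R) (psi : ell2) : ell2 :=
  insubd (0 : ell2) (fun v => (g v)%:C * psi v).

Lemma mulopE (g : V -> R) (psi : ell2) (M : R) (v : V) :
  (forall w, `|g w| <= M) -> mulop g psi v = (g v)%:C * psi v.
Proof.
move=> gM; rewrite /mulop [_ v](_ : _ = val (insubd (0 : ell2)
  (fun v => (g v)%:C * psi v)) v) // insubdK // inE.
apply: (@le_lt_trans _ _ (M ^+ 2 * fine (sqnorm psi))%:E); last exact: ltry.
apply: sqnorm_le => A finA.
apply: (@le_trans _ _ (M ^+ 2 * \sum_(w \in A) normc (psi w) ^+ 2)).
  rewrite !fsbig_finite // mulr_sumr; apply: ler_sum => w _.
  rewrite normcM exprMn ler_wpM2r ?sqr_ge0 //.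
  rewrite [normc _](_ : _ = `|g w|); first by rewrite lerXn2r ?nnegrE // (le_trans _ (gM w)).
  by rewrite /= expr0n addr0 sqrtr_sqr.
by rewrite ler_wpM2l ?sqr_ge0 ?le_sqnorm ?sqnorm_fin.
Qed.

Definition commutator (A B : ell2 -> ell2) (psi : ell2) : ell2 :=
  A (B psi) - B (A psi).

End ell2.

(* Limit of the finite partial sums along the net of finite subsets ordered
   by inclusion. *)
Definition finsubsets (T : choiceType) : set_system {fset T} :=
  filter_from [set: {fset T}] (fun A => [set B | A `<=` B]%fset).

Definition usum (T : choiceType) (K : numFieldType) (E : normedModType K)
    (F : T -> E) : E :=
  lim ((fun A : {fset T} => \sum_(t <- A) F t) @ @finsubsets T).

Definition inner (R : realType) (V : choiceType) (phi psi : ell2 R V) : R[i]^o :=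
  usum (fun v => ((phi v)^* * psi v : R[i]^o)).

Lemma usum_finite (T : choiceType) (K : numFieldType) (E : normedModType K)
    (F : T -> E) (A : {fset T}) :
  (forall t, t \notin A -> F t = 0) -> usum F = \sum_(t <- A) F t.
Proof.
move=> F0.
have FF : ProperFilter (@finsubsets T).
  apply: filter_from_proper; last by move=> B _; exists B => /=.
  apply: filter_from_filter; first by exists fset0.
  move=> B1 B2 _ _; exists (B1 `|` B2)%fset => // B /=.
  by rewrite fsubUset => /andP[].
apply/cvg_lim; first exact: norm_hausdorff.
apply: cvg_near_cst; exists A => // B /= AB.
rewrite (big_fset_incl _ AB) // => t _ tA; exact: F0.
Qed.

Lemma inner_delta (R : realType) (V : choiceType) (v : V) (psi : ell2 R V) :
  inner (delta R v) psi = psi v.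
Proof.
have deltaE w : delta R v w = ((w == v)%:R : R[i]) by [].
rewrite /inner (@usum_finite _ _ _ _ [fset v]%fset).
  rewrite big_seq_fset1 deltaE eqxx -[RHS](@mul1r R[i]).
  by congr (_ * _); apply: (rmorph1 (@conjc R)).
move=> w; rewrite in_fset1 => /negbTE wv; rewrite deltaE wv.
rewrite -[RHS](@mul0r R[i] (psi w)).
by congr (_ * _); apply: (rmorph0 (@conjc R)).
Qed.

Definition schrodinger (R : realType) (V : choiceType) (e : rel V)
    (H : ell2 R V -> ell2 R V) : Prop :=
  exists Q : V -> R, (exists M, forall v, `|Q v| <= M) /\
    forall psi v,
      H psi v = \sum_(u \in [set u | e u v]) (psi u - psi v) + (Q v)%:C * psi v.

Section localization.
Variables (R : realType) (V : choiceType) (e : rel V).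

Definition chi (f : nat -> R) (u : V) : V -> R := fun v => f (dist e v u).

(* The operator - \sum_u 2 [H, chi_u]^2, the infinite sum being taken in the
   strong operator topology. *)
Definition Cop (H : ell2 R V -> ell2 R V) (f : nat -> R) (psi : ell2 R V) :
    ell2 R V :=
  - usum (fun u => let X := commutator H (mulop (chi f u)) in X (X psi) *+ 2).

End localization.

(* Main.v *)
(* The commutator [H, chi_u] has off-diagonal entries chi_u(x) - chi_u(w) on
   the edges, so C_{v,v} = 2 sum_u sum_{x ~ v} (f(d(x,u)) - f(d(v,u)))^2.  A
   vertex u at distance k + 1 from v has a neighbour x of v at distance k, so
   with g_k = f(k) - f(k+1) this is at least 2 sum_{k <= r} S(k+1) g_k^2.
   As sum_k g_k = 1, Cauchy-Schwarz reduces the claim to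
   sum_k 1/S(k+1) < 4 alpha.  Since S >= 1 and alpha S >= N, one has
   1/S(k) <= 4 alpha^2 (1/(N(k-1) + alpha) - 1/(N(k) + alpha)), and the right
   hand side telescopes to less than 4 alpha. *)
Require Import Defs.
From mathcomp Require Import all_boot all_order all_algebra.
From mathcomp Require Import finmap.
From mathcomp Require Import boolp classical_sets functions cardinality fsbigop.
From mathcomp Require Import reals ereal topology normedtype sequences.
From mathcomp Require Import complex ring lra.

Set Implicit Arguments.
Unset Strict Implicit.
Unset Printing Implicit Defensive.

Import Order.TTheory GRing.Theory Num.Theory.
Local Open Scope classical_set_scope.
Local Open Scope ring_scope.

(** * Graph distance and growth of balls *)

Lemma walk_sym (V : choiceType) (e : rel V) (u v : V) (n : nat) :
  symmetric e -> walk e u v n -> walk e v u n.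
Proof.
move=> es [p [pp lp sp]]; exists (rev (belast u p)); split.
- rewrite -lp; have := rev_path e u p; rewrite /= => ->.
  by rewrite (@eq_path _ _ e) // => x y; rewrite es.
- by case: p {pp sp} lp => [/= ->//|x p] /= lp; rewrite rev_cons last_rcons.
- by rewrite size_rev size_belast.
Qed.

Lemma dist_sym (V : choiceType) (e : rel V) (u v : V) :
  symmetric e -> connected_graph e -> dist e u v = dist e v u.
Proof.
move=> es conn; apply/eqP; rewrite eqn_leq.
by apply/andP; split; apply: dist_walk; apply: walk_sym => //; exact: walk_dist.
Qed.

Lemma dist_edge (V : choiceType) (e : rel V) (u x v : V) :
  connected_graph e -> e x v -> (dist e u v <= (dist e u x).+1)%N.
Proof.
move=> conn xv; have [p [pp lp sp]] := walk_dist u x conn.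
apply: dist_walk; exists (rcons p v).
by rewrite rcons_path pp lp last_rcons size_rcons sp.
Qed.

(** Dropping the last edge of a shortest walk leaves a walk of length [n]; its endpoint cannot be
    closer to [u], since one edge leads from it to [v]. *)
Lemma dist_predecessor (V : choiceType) (e : rel V) (u v : V) (n : nat) :
  connected_graph e -> dist e u v = n.+1 -> exists2 x, e x v & dist e u x = n.
Proof.
move=> conn d; have [p [pp lp sp]] := walk_dist u v conn.
case/lastP: p pp lp sp => [|p y]; first by rewrite d.
rewrite rcons_path last_rcons size_rcons d => /andP[pp ly] yv [sp].
rewrite {}yv in ly *; exists (last u p) => //.
apply/eqP; rewrite eqn_leq; apply/andP; split.
  by apply: dist_walk; exists p.
by rewrite -ltnS -d; exact: dist_edge.
Qed.

(** If two consecutive balls agreed, induction on the distance through predecessors would put every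
    vertex in the finite ball of radius [k]. *)
Lemma ball_cardS_gt (V : choiceType) (e : rel V) (v : V) (k : nat) :
  simple_graph e -> connected_graph e -> bounded_degree e ->
  infinite_set [set: V] -> (ball_card e v k < ball_card e v k.+1)%N.
Proof.
move=> sg conn bd inf; apply: fproper_ltn_card.
rewrite fproperE; apply/andP; split.
  apply/fsubsetP => u; rewrite !in_fset_set; try exact: finite_ball.
  by rewrite !inE /Defs.ball /= => /leqW.
apply/fsubsetP => sub; apply: inf.
apply: (@sub_finite_set _ _ (Defs.ball e v k)); last exact: finite_ball.
move=> u _; rewrite /Defs.ball /=; elim: (dist e v u) {-2}u (erefl (dist e v u)).
  by move=> w ->.
move=> n IH w dw; have [x xw dx] := dist_predecessor conn dw.
have := sub w; rewrite !in_fset_set; try exact: finite_ball.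
rewrite !inE /Defs.ball /=; apply.
by rewrite dw ltnS -dx IH.
Qed.

(** * Commutators with multiplication operators and the diagonal of [Cop] *)

Lemma finite_neighbours (V : choiceType) (e : rel V) (v : V) :
  bounded_degree e -> finite_set [set u | e u v].
Proof. by move=> [d dP]; exact: (card_le_finite (dP v) (finite_II d)). Qed.

(** The potential and the diagonal part of the Laplacian commute with multiplication by [g]; only
    the hopping terms survive. The bound [M] keeps [mulop] away from its default value. *)
Lemma commutator_schrodingerE (R : realType) (V : choiceType) (e : rel V)
    (H : ell2 R V -> ell2 R V) (g : V -> R) (M : R) (psi : ell2 R V) (v : V) :
  bounded_degree e -> schrodinger e H -> (forall u, `|g u| <= M) ->
  commutator H (mulop g) psi v =
    \sum_(u \in [set u | e u v]) (g u - g v)%:C%C * psi u.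
Proof.
move=> bd [Q [_ HE]] gM; have fin := finite_neighbours v bd.
have subE (a b : ell2 R V) w : (a - b) w = a w - b w by [].
rewrite /commutator subE (mulopE _ _ gM) !HE (mulopE _ _ gM) mulrDr opprD.
rewrite mulrCA addrACA subrr addr0 !fsbig_finite //= mulr_sumr -sumrB.
apply: eq_bigr => u _; rewrite (mulopE _ _ gM) rmorphB /=; ring.
Qed.


Lemma commutator_delta (R : realType) (V : choiceType) (e : rel V)
    (H : ell2 R V -> ell2 R V) (g : V -> R) (M : R) (v x : V) :
  bounded_degree e -> schrodinger e H -> (forall u, `|g u| <= M) ->
  commutator H (mulop g) (delta R v) x =
    if e v x then (g v - g x)%:C%C else 0.
Proof.
move=> bd HS gM; have fin := finite_neighbours x bd.
rewrite (commutator_schrodingerE _ _ bd HS gM) fsbig_finite //=.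
have deltaE u : delta R v u = ((u == v)%:R : R[i]) by [].
have in_nbr u : (u \in fset_set [set u | e u x]) = e u x.
  by rewrite in_fset_set //; apply/idP/idP; rewrite inE.
case: ifP => evx.
  rewrite (big_fsetD1 v) ?in_nbr //= eqxx mulr1 big_seq big1 ?addr0 //.
  by move=> u; rewrite !inE => /andP[/negbTE -> _]; rewrite mulr0.
rewrite big_seq big1 // => u; rewrite in_nbr.
by case: eqP => [->|_]; rewrite ?evx ?mulr0.
Qed.

(** The kernel of the commutator is real and antisymmetric, so each path from [v] to a neighbour [x]
    and back contributes minus a square. *)
Lemma commutator_sqr_delta_diag (R : realType) (V : choiceType) (e : rel V)
    (H : ell2 R V -> ell2 R V) (g : V -> R) (M : R) (v : V) :
  simple_graph e -> bounded_degree e -> schrodinger e H ->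
  (forall u, `|g u| <= M) ->
  commutator H (mulop g) (commutator H (mulop g) (delta R v)) v =
    - (\sum_(x \in [set x | e x v]) (g x - g v) ^+ 2)%:C%C.
Proof.
move=> [es _] bd HS gM; have fin := finite_neighbours v bd.
rewrite (commutator_schrodingerE _ _ bd HS gM) !fsbig_finite //.
rewrite rmorph_sum -sumrN big_seq [RHS]big_seq; apply: eq_bigr => x.
rewrite in_fset_set // inE => xv; have {}xv : e x v := xv.
rewrite (commutator_delta _ _ bd HS gM) es xv expr2 rmorphM -mulrN -rmorphN.
by rewrite opprB.
Qed.

Lemma inner_Cop_delta (R : realType) (V : choiceType) (e : rel V)
    (H : ell2 R V -> ell2 R V) (f : nat -> R) (r : nat) (v : V) :
  simple_graph e -> connected_graph e -> bounded_degree e ->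
  schrodinger e H -> (forall k, `|f k| <= 1) ->
  (forall k, (r < k)%N -> f k = 0) ->
  inner (delta R v) (Cop e H f (delta R v)) =
    (2 * \sum_(u <- fset_set (Defs.ball e v r.+1))
           \sum_(x \in [set x | e x v])
             (f (dist e u x) - f (dist e u v)) ^+ 2)%:C%C.
Proof.
move=> sg conn bd HS f1 f0; have [es _] := sg.
have gM u w : `|chi e f u w| <= 1 by exact: f1.
have chiE u w : chi e f u w = f (dist e u w) by rewrite /chi dist_sym.
rewrite inner_delta /Cop.
(* For [u] farther than [r.+1] from [v], [chi] vanishes at [v] and at all its neighbours, so the
   commutator kills [delta R v] and the sum over [u] is finite. *)
rewrite (@usum_finite _ _ _ _ (fset_set (Defs.ball e v r.+1))); last first.
  move=> u; rewrite in_fset_set; last exact: finite_ball.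
  rewrite notin_setE /Defs.ball /= => /negP; rewrite -ltnNge dist_sym // => ru.
  have X0 : commutator H (mulop (chi e f u)) (delta R v) = 0.
    apply/val_inj/funext => x; rewrite -[LHS]/(commutator _ _ _ x).
    rewrite (commutator_delta _ _ bd HS (gM u)); case: ifP => // vx.
    rewrite !chiE !f0 ?subrr //; last exact: ltnW.
    by rewrite -ltnS (leq_trans ru) // dist_edge // es.
  (* [H] is a bare function, so that the commutator maps 0 to 0 is read off its pointwise
     formula. *)
  rewrite X0; apply/val_inj/funext => x.
  rewrite -[LHS]/((commutator _ _ _ *+ 2 : ell2 R V) x).
  have eval2 (a : ell2 R V) : (a *+ 2) x = a x *+ 2 by [].
  rewrite eval2 (commutator_schrodingerE _ _ bd HS (gM u)).
  rewrite fsbig_finite ?big1 ?mul0rn //=; last exact: finite_neighbours.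
  by move=> y _; rewrite [X in _ * X](_ : _ = 0) ?mulr0.
have evalN (a : ell2 R V) : (- a) v = - a v by [].
have evalD (a b : ell2 R V) : (a + b) v = a v + b v by [].
have eval2 (a : ell2 R V) : (a *+ 2) v = a v *+ 2 by [].
rewrite evalN (big_morph (fun a : ell2 R V => a v) evalD (erefl : (0 : ell2 R V) v = 0)).
rewrite -sumrN mulr_sumr rmorph_sum; apply: eq_bigr => u _.
rewrite eval2 (commutator_sqr_delta_diag _ sg bd HS (gM u)).
under eq_fsbigr do rewrite !chiE.
by rewrite mulNrn opprK -[RHS]/((2 * _)%:C%C) mulrC mulr_natr rmorphMn.
Qed.

(** * Telescoping lower bound *)

(* With [t = 1 / (4 a)], the Cauchy-Schwarz weight [1 / (y - x)] is dominated
   by the increment of the bounded potential [- 4 a^2 / (_ + a)]. *)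
Lemma potential_increment (F : realFieldType) (a x y g : F) :
  0 < a -> 0 <= x -> 1 <= y - x -> y <= a * (y - x) ->
  g / (2 * a) - ((x + a)^-1 - (y + a)^-1) / 4 <= (y - x) * g ^+ 2.
Proof.
move=> a0 x0 s1 ya; set s := y - x in s1 ya *.
have s0 : 0 < s by lra.
have xa0 : 0 < x + a by lra.
have ya0 : 0 < y + a by rewrite /s in s1; lra.
have sq : (x + a) * (y + a) <= (2 * a * s) ^+ 2.
  (* Adds [y <= a * s] and [a <= a * s], the latter from [1 <= s]. *)
  have h : y + a <= 2 * a * s by nra.
  have h' : x + a <= 2 * a * s by rewrite /s in h s1 *; lra.
  by rewrite expr2; apply: ler_pM => //; lra.
have weight : (4 * a ^+ 2 * s)^-1 <= ((x + a)^-1 - (y + a)^-1).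
  have -> : (x + a)^-1 - (y + a)^-1 = s / ((x + a) * (y + a)).
    by rewrite /s; field; rewrite !gt_eqF.
  rewrite ler_pdivlMr ?mulr_gt0 // mulrC ler_pdivrMr; last first.
    by rewrite !mulr_gt0 ?exprn_gt0.
  by apply: le_trans sq _; rewrite le_eqVlt; apply/orP; left; apply/eqP; ring.
(* Completing the square: the two sides differ by [s * (g - 1 / (4 * a * s)) ^+ 2]. *)
have young : g / (2 * a) - (4 * a ^+ 2 * s)^-1 / 4 <= s * g ^+ 2.
  rewrite -subr_ge0.
  have -> : s * g ^+ 2 - (g / (2 * a) - (4 * a ^+ 2 * s)^-1 / 4) =
    s * (g - (4 * a * s)^-1) ^+ 2.
    by field; rewrite !gt_eqF.
  by rewrite mulr_ge0 ?sqr_ge0 // ltW.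
by apply: le_trans young; lra.
Qed.

(** By induction on [n]: the sphere of radius [n.+1] adds [N n.+1 - N n] equal terms, which
    [potential_increment] bounds below by the increment of the left side. The centre [v] contributes
    0, because [0.-1 = 0]. *)
Lemma sum_decrement_ge (R : realType) (V : choiceType) (e : rel V) (N : nat -> nat)
    (alpha : R) (f : nat -> R) (v : V) (n : nat) :
  simple_graph e -> connected_graph e -> bounded_degree e ->
  (forall k, ball_card e v k = N k) -> 0 < alpha ->
  (forall k, (N k < N k.+1)%N) ->
  (forall k, (N k.+1)%:R <= alpha * ((N k.+1)%:R - (N k)%:R)) ->
  (f 0 - f n) / (2 * alpha)
    - (((N 0)%:R + alpha)^-1 - ((N n)%:R + alpha)^-1) / 4 <=
  \sum_(u <- fset_set (Defs.ball e v n))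
     (f (dist e v u).-1 - f (dist e v u)) ^+ 2.
Proof.
move=> sg conn bd NE a0 Nlt Na; elim: n => [|n IH].
  rewrite !subrr !mul0r subr0; apply: sumr_ge0 => u _; exact: sqr_ge0.
set B := fun k => fset_set (Defs.ball e v k).
have inB u k : (u \in B k) = (dist e v u <= k)%N.
  by rewrite in_fset_set; [apply/idP/idP; rewrite inE | exact: finite_ball].
have sub : (B n `<=` B n.+1)%fset.
  by apply/fsubsetP => u; rewrite !inB => /leqW.
rewrite -/(B n.+1) (big_fsetID _ [in B n]) /=.
have -> : [fset u in B n.+1 | u \in B n]%fset = B n.
  apply/fsetP => u; rewrite !inE /= andbC.
  by case un : (u \in B n) => //=; rewrite (fsubsetP sub).
have -> : [fset u in B n.+1 | u \notin B n]%fset = (B n.+1 `\` B n)%fset.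
  by apply/fsetP => u; rewrite !inE /= andbC.
have -> : \sum_(u <- (B n.+1 `\` B n)%fset)
      (f (dist e v u).-1 - f (dist e v u)) ^+ 2 =
    ((N n.+1)%:R - (N n)%:R) * (f n - f n.+1) ^+ 2.
  rewrite big_seq (eq_bigr (fun=> (f n - f n.+1) ^+ 2)); last first.
    move=> u; rewrite in_fsetD !inB -ltnNge => d.
    by have -> : dist e v u = n.+1 by apply/eqP; rewrite eqn_leq andbC.
  rewrite -big_seq big_const_seq count_predT iter_addr addr0 -[LHS]mulr_natl.
  rewrite -/(#|` B n.+1 `\` B n|)%fset cardfsD (fsetIidPr sub).
  by rewrite -!NE -natrB // fsubset_leq_card.
have := @potential_increment _ alpha (N n)%:R (N n.+1)%:R (f n - f n.+1) a0.
rewrite ler0n Na => /(_ isT) /(_ _ isT).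
have -> : 1 <= (N n.+1)%:R - (N n)%:R :> R.
  by rewrite lerBrDr -[1 + _](natrD _ 1%N) ler_nat add1n.
move=> /(_ isT) step; apply: le_trans (lerD IH step).
by lra.
Qed.

Theorem theorem2p3 (R : realType) (V : choiceType) (e : rel V)
    (H : ell2 R V -> ell2 R V) (N : nat -> nat) (alpha : R)
    (f : nat -> nat -> R) :
  simple_graph e -> connected_graph e -> bounded_degree e ->
  infinite_set [set: V] ->
  uniform_graph e -> (forall u k, ball_card e u k = N k) ->
  schrodinger e H ->
  0 < alpha ->
  (ereal_sup [set ((N r)%:R / (sphere_card N r)%:R : R)%:E |
                r in [set r | (0 < r)%N]] <= alpha%:E)%E ->
  (forall r, (0 < r)%N ->
     [/\ forall k, 0 <= f r k <= 1,
         nonincreasing_seq (f r),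
         f r 0%N = 1,
         forall k, (k <= r)%N -> f r k != 0 &
         forall k, (r < k)%N -> f r k = 0]) ->
  forall (r : nat) (v : V), (0 < r)%N ->
    1 / (2 * alpha) < Normc.normc (inner (delta R v) (Cop e H (f r) (delta R v))).
Proof.
move=> sg conn bd inf _ NE HS a0 supa hf r v r0.
have [f01 _ f0 _ fr] := hf r r0; have [es _] := sg.
have f1 k : `|f r k| <= 1 by have /andP[? ?] := f01 k; rewrite ger0_norm.
have Nlt k : (N k < N k.+1)%N by rewrite -!(NE v) ball_cardS_gt.
have Na k : (N k.+1)%:R <= alpha * ((N k.+1)%:R - (N k)%:R) :> R.
  have : (((N k.+1)%:R / (sphere_card N k.+1)%:R : R)%:E <= alpha%:E)%E.
    by apply: le_trans supa; apply: ereal_sup_ubound; exists k.+1.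
  rewrite lee_fin /= natrB; last exact: ltnW.
  by rewrite ler_pdivrMr // subr_gt0 ltr_nat.
(* The radius is [r.+1], where [f r] first vanishes, so that its total drop is 1. *)
have lower := @sum_decrement_ge _ _ _ _ alpha (f r) v r.+1 sg conn bd (NE v) a0 Nlt Na.
rewrite (inner_Cop_delta _ sg conn bd HS f1 fr).
set S := \sum_(u <- _) _.
have : (f r 0 - f r r.+1) / (2 * alpha)
    - (((N 0)%:R + alpha)^-1 - ((N r.+1)%:R + alpha)^-1) / 4 <= S.
  (* Among the neighbours of [v], only one lying a step closer to [u] is kept. *)
  apply: le_trans lower _; apply: ler_sum => u _.
  have fin := finite_neighbours v bd.
  rewrite fsbig_finite //= dist_sym //; case d : (dist e u v) => [|n].
    by rewrite subrr expr0n; apply: sumr_ge0 => x _; exact: sqr_ge0.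
  have [x xv dx] := dist_predecessor conn d.
  rewrite (big_fsetD1 x) /=; last by rewrite in_fset_set // inE.
  by rewrite dx lerDl; apply: sumr_ge0 => y _; exact: sqr_ge0.
rewrite f0 (fr r.+1) // subr0 => lowS.
(* These bounds put the potential difference strictly below [1 / alpha], whence
   [S > 1 / (2 * alpha) - 1 / (4 * alpha)]; the factor 2 in [Cop] then gives the claim. *)
have N0 : ((N 0)%:R + alpha)^-1 <= alpha^-1.
  by rewrite lef_pV2 ?posrE ?ltr_wpDl ?ler0n // lerDr.
have Nr : 0 < ((N r.+1)%:R + alpha)^-1 by rewrite invr_gt0 ltr_wpDl.
rewrite -[X in Normc.normc X]/((2 * S)%:C%C).
have -> : Normc.normc (2 * S)%:C%C = `|2 * S|.
  by rewrite /= expr0n addr0 sqrtr_sqr.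
apply: lt_le_trans (ler_norm _).
move: lowS; rewrite !div1r !invfM; lra.
Qed.
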